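(* Given a natural number $N\geq 1$, there exist a pruned tree $\mathscr{P}\subset\mathscr{B}$ that is lacunary of order $N$ and a point $(1,y)\in\mathbb{R}^2$ with $1\le y\le 3/2$ such that $\mathrm{Pr}_{\mathscr{P}}(1,y)=1$.
   Context: Dyadic intervals. For a binary string $0j_1\ldots j_k$ with each $j_i\in\{0,1\}$ and $k\ge 0$, $Q_{0j_1\ldots j_k}$ is the closed interval $[\sum_{i=1}^k2^{-i}j_i,\ \sum_{i=1}^k2^{-i}j_i+2^{-k}]$; in particular $Q_0=[0,1]$. Binary tree. $\mathscr{B}$ is the graph whose vertices are $0$ and all finite strings $0a_1\ldots a_k$ with $a_i\in\{0,1\}$, with edges joining $0$ to $0a_1$ and $0a_1\ldots a_{k-1}$ to $0a_1\ldots a_{k-1}a_k$. A vertex $0a_1\ldots a_k$ has height $k$, written $h(0a_1\ldots a_k)=k$, and $h(0)=0$. The height $h(\mathscr{T})$ of a nonempty subtree $\mathscr{T}\subset\mathscr{B}$ is the supremum of the heights of its vertices. For a natural number $n$, $\mathscr{B}^n$ is the truncation of $\mathscr{B}$ to its vertices of height at most $n$. If $u,v$ are joined by an edge and $h(v)=1+h(u)$, then $u$ is the parent of $v$ and $v$ is a child of $u$; ancestors and descendants are obtained by following chains of parents and children. A vertex of a subtree $\mathscr{T}$ splits in $\mathscr{T}$ (is a splitting vertex) if it has two children in $\mathscr{T}$. A ray in $\mathscr{T}$ is a (possibly infinite) maximal sequence of vertices $v_1,v_2,\ldots$ of $\mathscr{T}$ with $v_{j+1}$ a child of $v_j$; it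 is maximal in the sense that it does not terminate at a vertex having descendants in $\mathscr{T}$. $\mathfrak{R}_{\mathscr{T}}(v)$ is the set of rays in $\mathscr{T}$ starting at $v$. For a ray $R$ in $\mathscr{T}$, $\mathrm{split}(R)$ is the number of vertices on $R$ that split in $\mathscr{T}$, and $\mathrm{split}_{\mathscr{T}}(v)=\min_{R\in\mathfrak{R}_{\mathscr{T}}(v)}\mathrm{split}(R)$. Lacunary trees. A tree $\mathscr{T}\subset\mathscr{B}$ is lacunary of order $0$ if it consists of a single ray containing $0$. It is lacunary of order $N$ ($N\ge1$) if all of its splitting vertices lie on a lacunary tree of order $N-1$; it is understood that a tree said to be lacunary of order $N$ is not lacunary of any order lower than $N$. Pruned trees. If $\mathscr{P}\subset\mathscr{B}$ is lacunary of order $N$ and of finite height $h(\mathscr{P})$, then $\mathscr{P}$ is pruned if every ray in $\mathfrak{R}_{\mathscr{P}}(0)$ contains, for each $1\le j\le N$, exactly one vertex $v_j$ that splits in $\mathscr{P}$ and satisfies $\mathrm{split}_{\mathscr{P}}(v_j)=j$. Sticky maps. A map $f:\mathscr{B}^n\to\mathscr{B}^n$ is sticky if $h(f(u))=h(u)$ for every $u\in\mathscr{B}^n$ and $f(u)$ is an ancestor of $f(v)$ whenever $u$ is an ancestor of $v$. A sticky map $\sigma:\mathscr{B}^{h(\mathscr{T})}\to\mathscr{T}$ is one whose values lie in $\mathscr{T}$. The set $K_\sigma$. Let $\mathscr{T}\subset\mathscr{B}$ be a tree of finite height $h=h(\mathscr{T})$ whose vertices consist of a collection of vertices of height $h$ together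 with all of their ancestors, and let $\sigma:\mathscr{B}^{h}\to\mathscr{T}$ be sticky. For each string $0j_1\ldots j_h$, let $d_{\sigma,0j_1\ldots j_h}\in[0,1]$ be the left-hand endpoint of the interval $Q_{\sigma(0j_1\ldots j_h)}$, and let $\rho_{\sigma,0j_1\ldots j_h}$ be the interior of the union of all lines in $\mathbb{R}^2$ passing through $\{0\}\times Q_{0j_1\ldots j_h}$ in the direction $(1,d_{\sigma,0j_1\ldots j_h})$. Then $K_\sigma=\bigcup_{j_1,\ldots,j_h\in\{0,1\}}\rho_{\sigma,0j_1\ldots j_h}$. Probability. For a pruned tree $\mathscr{T}$ of finite height and lacunary order $N$ and a point $(x,y)\in\mathbb{R}^2$, $\mathrm{Pr}_{\mathscr{T}}(x,y)$ is the probability, over all sticky maps $\sigma:\mathscr{B}^{h(\mathscr{T})}\to\mathscr{T}$ (a finite set, with the uniform probability), that $(x,y)\in K_\sigma$. *)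

(* Defs.v *)
From HB Require Import structures.
From mathcomp Require Import all_boot all_order all_algebra.
From mathcomp Require Import all_classical all_reals all_analysis.
From Stdlib Require Import Relation_Operators.
Set Implicit Arguments.
Unset Strict Implicit.
Unset Printing Implicit Defensive.
Import Order.TTheory GRing.Theory Num.Theory.
Import numFieldNormedType.Exports.
Local Open Scope classical_set_scope.
Local Open Scope ring_scope.

(* The string 0 a_1 ... a_k is the list [:: a_1; ...; a_k]: the leading 0 is
   dropped, the root 0 is [::] and the height of a vertex is its [size]. *)
Definition vertex : Type := seq bool.

(* [child u v] : v is a child of u. *)
Definition child (u v : vertex) : bool := [exists a : bool, v == rcons u a].

(* [ancestor u v] : u is a (proper) ancestor of v. *)
Definition ancestor : vertex -> vertex -> Prop := clos_trans vertex child.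

(* A subtree of the binary tree is identified with its vertex set: a nonempty
   set of vertices any two of which are joined by a path inside the set. *)
Definition is_tree (T : set vertex) : Prop :=
  T !=set0 /\
  forall u v, T u -> T v ->
    clos_refl_sym_trans vertex (fun a b => [/\ T a, T b & child a b]) u v.

Definition has_height (T : set vertex) (h : nat) : Prop :=
  supremums [set size v | v in T] h.

Definition splits (T : set vertex) (v : vertex) : Prop :=
  [/\ T v, T (rcons v false) & T (rcons v true)].

(* Nonempty sequences of vertices: [FinSeq v s] is v followed by s, and
   [InfSeq f] is f 0, f 1, f 2, ... *)
Inductive vseq : Type :=
| FinSeq of vertex & seq vertex
| InfSeq of nat -> vertex.

Definition start (r : vseq) : vertex :=
  match r with FinSeq v _ => v | InfSeq f => f 0%N end.

Definition on (r : vseq) : set vertex :=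
  match r with
  | FinSeq v s => [set u | u \in v :: s]
  | InfSeq f => range f
  end.

Definition is_ray (T : set vertex) (r : vseq) : Prop :=
  on r `<=` T /\
  match r with
  | FinSeq v s => path child v s /\ ~ exists2 w, T w & ancestor (last v s) w
  | InfSeq f => forall i, child (f i) (f i.+1)
  end.

Definition rays_from (T : set vertex) (v : vertex) : set vseq :=
  [set r | is_ray T r /\ start r = v].

(* [split_ray T r k] : split(r) = k.  It holds for no k when infinitely many
   vertices of r split, i.e. when split(r) is infinite. *)
Definition split_ray (T : set vertex) (r : vseq) (k : nat) : Prop :=
  (on r `&` splits T #= `I_k)%card.

(* [split_vertex T v k] : split_T(v) = k, the minimum being finite. *)
Definition split_vertex (T : set vertex) (v : vertex) (k : nat) : Prop :=
  (exists2 r, rays_from T v r & split_ray T r k) /\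
  forall r l, rays_from T v r -> split_ray T r l -> (k <= l)%N.

(* Lacunary of order N or lower. *)
Fixpoint lacunary_le (N : nat) (T : set vertex) : Prop :=
  is_tree T /\
  match N with
  | 0 => exists r, [/\ is_ray T r, on r [::] & T = on r]
  | M.+1 => exists2 S, lacunary_le M S & splits T `<=` S
  end.

(* Lacunary of order exactly N; [lacunary0] and [lacunaryS] below give the
   usual recursive description. *)
Definition lacunary (N : nat) (T : set vertex) : Prop :=
  lacunary_le N T /\ forall M, (M < N)%N -> ~ lacunary_le M T.

Lemma lacunary_leW M N T :
  (M <= N)%N -> lacunary_le M T -> lacunary_le N T.
Proof.
elim: N => [|N IH]; first by rewrite leqn0 => /eqP ->.
rewrite leq_eqVlt => /predU1P[->//|]; rewrite ltnS => /IH{}IH /IH TN.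
have tT : is_tree T by case: N TN {IH} => [|N] [].
by split=> //; exists T => // v [].
Qed.

Lemma lacunary_leE N T :
  lacunary_le N T <-> exists2 M, (M <= N)%N & lacunary M T.
Proof.
split=> [|[M leMN [TM _]]]; last exact: lacunary_leW leMN TM.
elim/ltn_ind: N => N IH TN.
have [[M ltMN TM]|noM] := pselect (exists2 M, (M < N)%N & lacunary_le M T).
  by have [K leKM TK] := IH _ ltMN TM; exists K; rewrite ?(leq_trans leKM) 1?ltnW.
by exists N => //; split=> // M ltMN TM; apply: noM; exists M.
Qed.

Lemma lacunary0 T :
  lacunary 0 T <->
  is_tree T /\ exists r, [/\ is_ray T r, on r [::] & T = on r].
Proof. by split=> [[]|]. Qed.

Lemma lacunaryS N T :
  lacunary N.+1 T <->
  [/\ is_tree T, exists2 S, lacunary N S & splits T `<=` S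
    & forall M, (M <= N)%N -> ~ lacunary M T].
Proof.
split=> [[[tT [S SN TS]] minT]|[tT [S [SN minS] TS] minT]]; last first.
  split; first by split=> //; exists S.
  move=> M ltMN /lacunary_leE[K leKM]; apply: minT.
  by rewrite (leq_trans leKM).
split=> //; last by move=> M leMN [TM _]; apply: minT TM.
exists S => //; split=> // M ltMN SM; apply: (minT M.+1) => //.
by split=> //; exists S.
Qed.

Definition pruned (N : nat) (P : set vertex) : Prop :=
  [/\ lacunary N P, exists h, has_height P h
    & forall r, rays_from P [::] r -> forall j, (1 <= j <= N)%N ->
        exists! v, [/\ on r v, splits P v & split_vertex P v j]].

(* T consists of vertices of height h together with all their ancestors; this
   is the class of trees for which the random set [Kset] is considered. *)
Definition full_height (T : set vertex) (h : nat) : Prop :=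
  exists V : set vertex, (forall w, V w -> size w = h) /\
    T = V `|` [set v | exists2 w, V w & ancestor v w].

(* [h.-bseq bool] is the vertex set of the binary tree truncated at height h. *)
Definition sticky (h : nat) (T : set vertex)
    (f : {ffun h.-bseq bool -> h.-bseq bool}) : Prop :=
  [/\ forall u : h.-bseq bool, size (f u) = size u,
      forall u v : h.-bseq bool, ancestor u v -> ancestor (f u) (f v)
    & forall u : h.-bseq bool, T (f u)].

Section Kakeya.
Variable R : realType.

Definition left_end (w : vertex) : R :=
  \sum_(i < size w) 2 ^- i.+1 * (nth false w i)%:R.

Definition Q (w : vertex) : set R :=
  `[left_end w, left_end w + 2 ^- size w]%classic.

Definition line (p d : R * R) : set (R * R) :=
  [set (p.1 + t * d.1, p.2 + t * d.2) | t in [set: R]].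

Definition rho h (s : {ffun h.-bseq bool -> h.-bseq bool})
    (j : h.-bseq bool) : set (R * R) :=
  (\bigcup_(p in [set 0] `*` Q j) line p (1, left_end (s j)))°.

Definition Kset h (s : {ffun h.-bseq bool -> h.-bseq bool}) : set (R * R) :=
  \bigcup_(j in [set j : h.-bseq bool | size j = h]) rho s j.

Definition Pr (T : set vertex) (h : nat) (p : R * R) : R :=
  #|[pred s : {ffun h.-bseq bool -> h.-bseq bool} |
       `[< sticky T s /\ Kset s p >] ]|%:R /
  #|[pred s : {ffun h.-bseq bool -> h.-bseq bool} | `[< sticky T s >] ]|%:R.

End Kakeya.

(* Main.v *)
Require Import Defs.
From mathcomp Require Import all_boot all_order all_algebra.
From mathcomp Require Import all_classical all_reals all_analysis.
From mathcomp Require Import zify ring lra.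
From Stdlib Require Import Relation_Operators.
Set Implicit Arguments.
Unset Strict Implicit.
Unset Printing Implicit Defensive.
Import Order.TTheory GRing.Theory Num.Theory.
Import numFieldNormedType.Exports.
Local Open Scope classical_set_scope.
Local Open Scope ring_scope.

(** The tree consists of the strings whose consecutive blocks of two bits are
    01 or 10, cut off after N blocks; it is called [alt N] below.  A vertex of
    even height below 2N is free to choose its next block and splits, and a
    vertex of odd height has no choice.  So every ray carries exactly N
    splitting vertices, at heights 0, 2, ..., 2N - 2, and a ray started at
    height 2i carries N - i of them: this is the pruning condition.  The
    splitting vertices lie on [alt N.-1], whence order at most N by induction.
    The order is not lower, because a tree that contains the even vertices of
    [alt N] splits at all even vertices of [alt N.-1] ([lacunary_le_alt]).

    For the probability, a point (1, y) lies in the strip of a string j as soon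
    as y exceeds left_end j + left_end (f j) by less than 2^-h.  So let
    y = 1 + 4^-1 + ... + 4^-(N - 1) + 2^-(2N + 1); it is enough that every
    sticky f into the tree has a j of full height with
    left_end j + left_end (f j) = 1 + 4^-1 + ... + 4^-(N - 1).  Read in base 4,
    the digits of slopes are 1 or 2, and the equation asks that the digits of j
    and of f j add up to 4 at each place: 3 goes with 1 and 2 goes with 2.  Both
    digits 3 and 2 begin with the bit 1, whereas 1 and 2 already differ in their
    first bit.  Stickiness therefore makes f choose its next slope digit while j
    has only committed to the bit 1, and the second bit of j can still be adapted
    to that choice ([sticky_alt_hit]).  No f escapes. *)

(** * Vertices and subtrees of the binary tree *)

Lemma childP (u v : vertex) : reflect (exists a, v = rcons u a) (child u v).
Proof. by apply: (iffP existsP) => -[a /eqP]; exists a => //; apply/eqP. Qed.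

Lemma prefix_rconsr (u w : vertex) a :
  seq.prefix u (rcons w a) = (u == rcons w a) || seq.prefix u w.
Proof.
elim: w u => [|b w IH] [|c u] //=; last by rewrite IH eqseq_cons -andb_orr.
by rewrite orbF eqseq_cons; case: u.
Qed.

Lemma ancestorP (u v : vertex) :
  ancestor u v <-> seq.prefix u v /\ (size u < size v)%N.
Proof.
split.
  elim=> {u v} [u v /childP[a ->]|u v w _ [uv ltuv] _ [vw ltvw]].
    by rewrite prefix_rcons size_rcons.
  by rewrite (ltn_trans ltuv ltvw); split=> //; apply: prefix_trans vw.
case=> /prefixP[s ->]; rewrite size_cat.
elim/last_ind: s => [|s a IH]; first by rewrite addn0 ltnn.
move=> _; have [->|s0] := eqVneq s [::].
  by apply: t_step; apply/childP; exists a; rewrite cats1.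
apply: (t_trans _ _ _ (u ++ s)).
  by apply: IH; rewrite -[ltnLHS]addn0 ltn_add2l lt0n size_eq0.
by apply: t_step; apply/childP; exists a; rewrite rcons_cat.
Qed.

(** The edge from [v] to [rcons v a] is the only one that leads to the vertices
    extending [rcons v a], so a path inside [T] from [x] to [y] must use it. *)
Lemma tree_edge (T : set vertex) (x y : vertex) (v : vertex) a :
  is_tree T -> T x -> T y -> seq.prefix (rcons v a) x ->
  ~~ seq.prefix (rcons v a) y -> T v /\ T (rcons v a).
Proof.
move=> [_ conn] Tx Ty px py.
suff: seq.prefix (rcons v a) x != seq.prefix (rcons v a) y ->
    T v /\ T (rcons v a) by apply; rewrite px (negPf py).
elim: {x y Tx Ty px py} (conn x y Tx Ty) =>
  [x y [Tx Ty /childP[b Ey]]|x|x y _|x y z _ IH1 _ IH2].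
- rewrite {}Ey prefix_rconsr in Ty *.
  case: (rcons v a =P _) => [/rcons_inj [-> ->]|_] //=; last by rewrite eqxx.
- by rewrite eqxx.
- by rewrite eq_sym.
- have [->|/IH1 //] :=
    eqVneq (seq.prefix (rcons v a) x) (seq.prefix (rcons v a) y).
  exact: IH2.
Qed.

Lemma ray_chain T r u v : is_ray T r -> on r u -> on r v ->
  seq.prefix u v \/ seq.prefix v u.
Proof.
have pfx (a b : vertex) : child a b -> seq.prefix a b.
  by case/childP=> c ->; apply: prefix_rcons.
have ptr : transitive (@seq.prefix bool) by move=> b a c; apply: prefix_trans.
case: r => [s0 s|f] [_ /=].
  case=> /(sub_path pfx) ps _ /(nthP [::])[i li <-] /(nthP [::])[j lj <-].
  have H := sorted_leq_nth ptr (@prefix_refl _) [::] (s := s0 :: s) ps.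
  by case: (leqP i j) => [|/ltnW] /H; [left|right]; auto.
move=> cf [i _ <-] [j _ <-].
have H : {homo f : i j / (i <= j)%N >-> seq.prefix i j}.
  by apply: homo_leq => [x|x y z|k]; [exact: prefix_refl|exact: prefix_trans|exact: pfx].
by case: (leqP i j) => [|/ltnW] /H; [left|right].
Qed.

Lemma mem_child_path (v : vertex) (s : seq vertex) (u : vertex) : path child v s ->
  (u \in v :: s) = seq.prefix u (last v s) && (size v <= size u)%N.
Proof.
elim/last_ind: s u => [|s c IH] u /=.
  rewrite inE => _; apply/eqP/andP => [->|[/prefixP[t ->]]]; first by rewrite prefix_refl.
  by rewrite size_cat -[leqRHS]addn0 leq_add2l leqn0 size_eq0 => /eqP->; rewrite cats0.
rewrite rcons_path -rcons_cons mem_rcons last_rcons in_cons => /andP[ps /childP[a ->]].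
rewrite IH // prefix_rconsr; case: eqP => //= ->.
have /size_prefix := prefix_rcons (last v s) a.
have: last v s \in v :: s by apply: mem_last.
by rewrite IH // => /andP[_ le]; rewrite size_rcons => _; rewrite ltnW.
Qed.

(** * The tree of blocks 01 and 10 *)

(** The bits 2i and 2i + 1 form the i-th block.  A vertex of odd height ends with
    half a block, which the condition leaves free. *)
Definition alt (N : nat) : set vertex :=
  [set v | (size v <= N.*2)%N /\
     forall i, (i.*2.+1 < size v)%N -> nth false v i.*2.+1 = ~~ nth false v i.*2].

Lemma alt_prefix N u v : seq.prefix u v -> alt N v -> alt N u.
Proof.
case/prefixP=> s -> [sz d]; rewrite size_cat in sz d; split; first lia.
move=> i lti; move: (d i); rewrite !nth_cat lti (ltnW lti); apply; lia.
Qed.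

Lemma alt_nil N : alt N [::].
Proof. by []. Qed.

Lemma alt_even N v a :
  alt N v -> ~~ odd (size v) -> (size v < N.*2)%N -> alt N (rcons v a).
Proof.
move=> [sz d] ev lt; split; first by rewrite size_rcons.
move=> i; rewrite size_rcons !nth_rcons => lti.
have lti' : (i.*2.+1 < size v)%N by lia.
by rewrite lti' (ltnW lti') d.
Qed.

Lemma alt_odd N v a : odd (size v) ->
  alt N (rcons v a) <-> alt N v /\ a = ~~ last false v.
Proof.
move=> ov; have Ev : size v = ((size v)./2).*2.+1 by lia.
have lt : ((size v)./2.*2 < size v)%N by lia.
have nl : last false v = nth false v (size v)./2.*2 by rewrite -nth_last {1}Ev.
split=> [av|[[sz d] ->]].
  split; first exact: alt_prefix (prefix_rcons _ _) av.
  case: av => _ /(_ (size v)./2); rewrite -Ev size_rcons => /(_ (ltnSn _)).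
  by rewrite !nth_rcons ltnn eqxx lt nl.
split=> [|i]; first by rewrite size_rcons; lia.
rewrite size_rcons ltnS leq_eqVlt => /predU1P[Ei|lti].
  have -> : i = (size v)./2 by lia.
  by rewrite -Ev !nth_rcons ltnn eqxx lt nl.
by rewrite !nth_rcons lti (ltnW lti) d.
Qed.

Lemma alt_child N v : alt N v -> (size v < N.*2)%N -> exists a, alt N (rcons v a).
Proof.
move=> av lt; have [ov|ev] := boolP (odd (size v)).
  by exists (~~ last false v); apply/alt_odd.
by exists true; apply: alt_even.
Qed.

Lemma alt_leaf N v : alt N v ->
  exists w, [/\ alt N w, size w = N.*2 & seq.prefix v w].
Proof.
have [n] := ubnP (N.*2 - size v); elim: n v => // n IH v ltn av.
have [le|lt] := leqP N.*2 (size v).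
  by exists v; split=> //; [case: av => sv _; lia|exact: prefix_refl].
have [a ava] := alt_child av lt.
have [||w [aw sw pw]] := IH (rcons v a) => //; first by rewrite size_rcons; lia.
by exists w; split=> //; apply: prefix_trans pw; apply: prefix_rcons.
Qed.

Lemma alt_splits N v :
  splits (alt N) v <-> [/\ alt N v, ~~ odd (size v) & (size v < N.*2)%N].
Proof.
split=> [[av a0 a1]|[av ev lt]]; last by split=> //; apply: alt_even.
split=> //; last by case: a0; rewrite size_rcons.
by apply/negP=> ov; case/(alt_odd _ _ ov): a0 => _ E;
   case/(alt_odd _ _ ov): a1 => _; rewrite -E.
Qed.

Lemma alt_tree N : is_tree (alt N).
Proof.
split=> [|u v au av]; first by exists [::].
suff root w : alt N w ->
    clos_refl_sym_trans vertex
      (fun a b => [/\ alt N a, alt N b & child a b]) [::] w.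
  by apply: rst_trans (root v av); apply/rst_sym/root.
elim/last_ind: w => [_|w a IH aw]; first exact: rst_refl.
have aw' := alt_prefix (prefix_rcons w a) aw.
by apply: rst_trans (IH aw') _; apply: rst_step; split=> //; apply/childP; exists a.
Qed.

(** * Lacunary order *)

Lemma alt_lacunary_le N : lacunary_le N (alt N).
Proof.
elim: N => [|N IH]; (split; first exact: alt_tree).
  exists (FinSeq [::] [::]); split=> [||]; last 1 first.
  - rewrite predeqE => v; split=> /= [[]|].
      by rewrite leqn0 size_eq0 => /eqP-> _; rewrite inE.
    by rewrite inE => /eqP->.
  - split=> [v /=|]; first by rewrite inE => /eqP->.
    by split=> // -[w [sw _] /ancestorP[_ /=]]; lia.
  - by rewrite /= inE.
by exists (alt N) => // v /alt_splits[[_ d] ev lt]; split=> //; lia.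
Qed.

(** If [v] is an even vertex of [alt N], then [T] contains both v01 and v10, one
    below each child of [v]; being connected, it contains [v] and its children, so
    [v] splits.  Peeling off one order of lacunarity thus costs only one block,
    and the single ray of order 0 cannot contain both 01 and 10. *)
Lemma lacunary_le_alt N M T : lacunary_le M T ->
  (forall v, alt N v -> ~~ odd (size v) -> T v) -> (N <= M)%N.
Proof.
elim: M N T => [|M IH] [|N] T //= [tT].
  case=> r [rr _ ->] sub; exfalso.
  have a1 b : alt N.+1 [:: b; ~~ b].
    by split=> [|[|i]] //=; rewrite doubleS.
  by case: (ray_chain rr (sub _ (a1 true) isT) (sub _ (a1 false) isT)).
case=> S lS TS sub; apply: (IH N S lS) => v av ev; apply: TS.
(* Each of v01 and v10 lies outside the branch of the other, so both edges
   from v to its children are forced into T. *)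
have aext b : T (rcons (rcons v b) (~~ b)).
  apply: sub; last by rewrite !size_rcons /= negbK.
  apply/alt_odd; first by rewrite size_rcons.
  split; last by rewrite last_rcons.
  case: av => sv d; apply: alt_even => //; last by lia.
  by split=> //; lia.
have edge b : T v /\ T (rcons v b).
  apply: (tree_edge tT (aext b) (aext (~~ b))); first exact: prefix_rcons.
  rewrite !prefix_rconsr !negb_or; apply/and3P; split.
  - by apply/eqP => /(congr1 size)/eqP; rewrite !size_rcons; lia.
  - by apply/eqP => /rcons_inj []; case: b.
  - by apply/negP => /size_prefix; rewrite size_rcons ltnn.
by split; [case: (edge true)|case: (edge false)|case: (edge true)].
Qed.

Lemma alt_lacunary N : lacunary N (alt N).
Proof.
split=> [|M ltMN lM]; first exact: alt_lacunary_le.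
by have := lacunary_le_alt lM (fun v av _ => av); rewrite leqNgt ltMN.
Qed.

(** * Rays, split numbers and pruning *)

(** Vertices of height below 2N have a child in [alt N], so a maximal sequence can
    only stop at height 2N and is determined by its last vertex. *)
Lemma alt_rayE N v r : rays_from (alt N) v r -> exists w,
  [/\ alt N w, size w = N.*2, seq.prefix v w &
      on r = [set u : vertex | seq.prefix u w /\ (size v <= size u)%N]].
Proof.
case: r => [v0 s|f] [[sub /= rr] Ev]; rewrite ?{}Ev in rr sub *; last first.
  exfalso; have sz i : size (f i) = (size (f 0%N) + i)%N.
    elim: i => [|i IH]; first by rewrite addn0.
    by have /childP[a ->] := rr i; rewrite size_rcons IH addnS.
  have /sub [le _] : on (InfSeq f) (f N.*2.+1) by exists N.*2.+1.
  by rewrite sz in le; lia.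
case: rr => ps maxs; have lin := mem_last v s.
have aw : alt N (last v s) by apply: sub.
exists (last v s); split=> //.
- apply/eqP; rewrite eqn_leq; case: (aw) => -> _ /=; rewrite leqNgt.
  apply/negP => /(alt_child aw)[a awa]; apply: maxs; exists (rcons (last v s) a) => //.
  by apply/ancestorP; rewrite prefix_rcons size_rcons.
- by have := mem_head v s; rewrite (mem_child_path _ ps) => /andP[].
- by rewrite predeqE => u /=; rewrite (mem_child_path _ ps); split=> [/andP|] [-> ->].
Qed.

Lemma alt_ray_exists N v :
  alt N v -> exists s, rays_from (alt N) v (FinSeq v s).
Proof.
have [n] := ubnP (N.*2 - size v); elim: n v => // n IH v ltn av.
have [le|lt] := leqP N.*2 (size v).
  exists [::]; split=> //; split=> [u /=|]; first by rewrite inE => /eqP->.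
  by split=> // -[w [sw _] /ancestorP[_ /=]]; lia.
have [a ava] := alt_child av lt.
have [||s [[sub [ps mx]] _]] := IH (rcons v a) => //.
  by rewrite size_rcons; lia.
exists (rcons v a :: s); split=> //; split=> [u|].
  by rewrite /= inE => /predU1P[->//|us]; apply: sub.
by split=> //=; rewrite ps andbT; apply/childP; exists a.
Qed.

Lemma alt_split_ray N v r : ~~ odd (size v) -> rays_from (alt N) v r ->
  split_ray (alt N) r (N - (size v)./2).
Proof.
move=> ev /alt_rayE[w [aw sw pvw onr]].
pose g k := take ((size v)./2 + k).*2 w.
have szg k : (k < N - (size v)./2)%N -> size (g k) = ((size v)./2 + k).*2.
  by move=> lt; rewrite size_takel // sw leq_double; lia.
rewrite /split_ray; suff -> : on r `&` splits (alt N) = g @` `I_(N - (size v)./2).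
  apply: inj_card_eq => i j; rewrite !inE /= => lti ltj /(congr1 size).
  by rewrite !szg //; lia.
rewrite onr predeqE => u; split=> [[[puw le] /alt_splits[_ eu lt]]|[k /= lt <-]].
  exists ((size u)./2 - (size v)./2)%N => /=; first by lia.
  have Eu : take (size u) w = u by apply/eqP; rewrite -prefixE.
  by rewrite /g -[RHS]Eu; congr take; lia.
split; first by split; [exact: prefix_take|rewrite szg //; lia].
apply/alt_splits; rewrite szg // odd_double; split=> //; last by lia.
exact: alt_prefix (prefix_take _ _) aw.
Qed.

(** All rays from [v] have the same number of splitting vertices, so the minimum
    that defines the split number is that common value. *)
Lemma alt_split_vertex N v k : alt N v -> ~~ odd (size v) ->
  split_vertex (alt N) v k <-> k = (N - (size v)./2)%N.
Proof.
move=> av ev; have uniq r l : rays_from (alt N) v r -> split_ray (alt N) r l ->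
    l = (N - (size v)./2)%N.
  move=> /(alt_split_ray ev) rk rl; apply/card_eq_II.
  by apply: card_eq_trans rk; rewrite card_eq_sym.
split=> [[[r vr rk] _]|->]; first exact: uniq rk.
split=> [|r l vr rl]; last by rewrite (uniq r l).
have [s vs] := alt_ray_exists av.
by exists (FinSeq v s) => //; apply: alt_split_ray.
Qed.

Lemma alt_height N : has_height (alt N) N.*2.
Proof.
split=> [_ [v [sv _] <-] //|k ub].
have [w [aw sw _]] := alt_leaf (alt_nil N).
by apply: ub; exists w.
Qed.

Lemma alt_full_height N : full_height (alt N) N.*2.
Proof.
exists [set w | alt N w /\ size w = N.*2]; split=> [w []//|].
rewrite predeqE => v; split=> [av|[[]//|[w [aw _] /ancestorP[pvw _]]]].
  have [w [aw sw pvw]] := alt_leaf av.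
  have [E|ne] := eqVneq (size v) N.*2; first by left.
  right; exists w => //; apply/ancestorP; split=> //.
  by rewrite ltn_neqAle size_prefix // sw ne.
exact: alt_prefix aw.
Qed.

Lemma alt_pruned N : pruned N (alt N).
Proof.
split; [exact: alt_lacunary|by exists N.*2; exact: alt_height|].
move=> r /alt_rayE[w [aw sw _ onr]] j /andP[j1 jN].
have szj : size (take (N - j).*2 w) = (N - j).*2.
  by rewrite size_takel // sw leq_double leq_subr.
have aj : alt N (take (N - j).*2 w) by apply: alt_prefix (prefix_take _ _) aw.
(* The split number at height 2i is N - i, hence the height 2(N - j). *)
exists (take (N - j).*2 w); split.
  split; first by rewrite onr; split=> //; apply: prefix_take.
    by apply/alt_splits; rewrite szj odd_double; split=> //; lia.
  by apply/alt_split_vertex; rewrite ?szj ?odd_double //; lia.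
move=> v [+ /alt_splits[av ev lt] /(alt_split_vertex _ av ev) Ej].
rewrite onr => -[pvw _]; have <- : take (size v) w = v by apply/eqP; rewrite -prefixE.
by congr take; lia.
Qed.

(** * Sticky maps always hit the point *)

Lemma sticky_rcons h T (f : {ffun h.-bseq bool -> h.-bseq bool})
    (j : h.-bseq bool) b : sticky T f -> (size j < h)%N ->
  exists (j' : h.-bseq bool) a, val j' = rcons j b /\ val (f j') = rcons (f j) a.
Proof.
move=> [fsz fanc _] lt; have sz : (size (rcons j b) <= h)%N by rewrite size_rcons.
exists (Bseq sz); have anc : ancestor j (Bseq sz).
  by apply/ancestorP; rewrite prefix_rcons size_rcons.
have /ancestorP[/prefixP[s Es] _] := fanc _ _ anc.
have := fsz (Bseq sz); rewrite Es size_cat fsz /= size_rcons.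
case: s Es => [|a [|? ?]] Es /= => [|_|]; try lia.
by exists a; split=> //; rewrite Es cats1.
Qed.

Lemma left_end_rcons (R : realType) (u : vertex) a :
  left_end R (rcons u a) = left_end R u + 2 ^- (size u).+1 * a%:R.
Proof.
rewrite /left_end size_rcons big_ord_recr /= nth_rcons ltnn eqxx; congr (_ + _).
by apply: eq_bigr => i _; rewrite nth_rcons ltn_ord.
Qed.

(** The string [j] grows two bits at a time.  Appending 1 makes [f] append some bit
    [a]; appending the complement of [a] then makes [f] append that same
    complement, the only way to complete a block begun with [a].  With
    a' = 1 - a, the four bits add
    2^-(2m+1) (1 + a) + 2^-(2m+2) (a' + a') = 4^-m to the sum. *)
Lemma sticky_alt_hit (R : realType) N
    (f : {ffun (N.*2).-bseq bool -> (N.*2).-bseq bool}) m :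
  sticky (alt N) f -> (m <= N)%N ->
  exists j : (N.*2).-bseq bool, [/\ size j = m.*2 &
     left_end R j + left_end R (f j) = \sum_(i < m) 4 ^- i].
Proof.
move=> st; elim: m => [_|m IH ltm].
  exists [bseq]; split=> //.
  have [/(_ [bseq]) /= /size0nil -> _ _] := st.
  by rewrite /left_end /= !big_ord0 addr0.
have [j [sj Ej]] := IH (ltnW ltm).
have [|j1 [a [Ej1 Ef1]]] := sticky_rcons true st (j := j); first by rewrite sj; lia.
have [|j2 [b [Ej2 Ef2]]] := sticky_rcons (~~ a) st (j := j1).
  by rewrite Ej1 size_rcons sj; lia.
have [fsz _ fT] := st.
have Eb : b = ~~ a.
  have := fT j2; rewrite Ef2 Ef1 => /alt_odd []; last by rewrite last_rcons.
  by rewrite size_rcons fsz sj /= odd_double.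
exists j2; split; [by rewrite Ej2 Ej1 !size_rcons sj doubleS|].
rewrite Ej2 Ef2 Ej1 Ef1 !left_end_rcons !size_rcons fsz sj big_ord_recr /= -Ej Eb.
rewrite -[m.*2]mul2n !exprSr exprM; have -> : 2 ^+ 2 = 4 :> R by rewrite -natrX.
have : 4 ^+ m != 0 :> R by rewrite expf_neq0 // pnatr_eq0.
move: (4 ^+ m) => c c0; case: (a) => /=; field; exact: c0.
Qed.

(** The lines of slope d through {0} x Q_j sweep out exactly the points (a, b)
    for which b - a d lies in Q_j, and the inverse image of the open interval
    under this continuous function is open. *)
Lemma rho_mem (R : realType) h (s : {ffun h.-bseq bool -> h.-bseq bool})
    (j : h.-bseq bool) (x y : R) :
  left_end R j < y - x * left_end R (s j) < left_end R j + 2 ^- size j ->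
  rho s j (x, y).
Proof.
set d := left_end R (s j); set l := left_end R j; set e := l + _ => H.
pose g (p : R * R) := p.2 - p.1 * d.
have cg : continuous g.
  move=> p; apply: cvgB; first exact: cvg_snd.
  by apply: cvgMl; exact: cvg_fst.
have og : open (g @^-1` `]l, e[%classic).
  by apply: open_comp => [p _|]; [exact: cg|exact: interval_open].
have : g @^-1` `]l, e[%classic `<=`
    \bigcup_(p in [set 0] `*` Q j) line p (1, d).
  move=> [a b]; rewrite /g /= in_itv /= => /andP[h1 h2].
  exists (0, b - a * d).
    by split=> //=; rewrite /Q /= in_itv /= !ltW.
  by exists a => //; rewrite /= mulr1 add0r subrK.
by rewrite open_subsetE // => /(_ (x, y)); apply; rewrite /g /= in_itv.
Qed.

Lemma sum_inv4 (R : realType) N : (1 <= N)%N ->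
  1 <= (\sum_(i < N) 4 ^- i + 2 ^- N.*2.+1 : R) <= 3 / 2.
Proof.
move=> N1; have -> : \sum_(i < N) 4 ^- i = 4 / 3 - 4 / 3 * 4 ^- N :> R.
  elim: N {N1} => [|n IH]; first by rewrite big_ord0 expr0; lra.
  by rewrite big_ord_recr /= IH exprS invfM; lra.
have -> : 2 ^- N.*2.+1 = 2^-1 * 4 ^- N :> R.
  by rewrite exprS invfM -mul2n exprM -natrX.
have : 0 <= (4 ^- N : R) <= 4^-1.
  rewrite invr_ge0 exprn_ge0 //= lef_pV2 ?posrE ?exprn_gt0 //.
  by apply: ler_eXnr => //; rewrite ler1n.
lra.
Qed.

(** The uniform probability makes sense only if there is a sticky map: let the
    height alone decide the image, along one fixed ray. *)
Lemma sticky_exists N : exists f, sticky (h := N.*2) (alt N) f.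
Proof.
have [w [aw sw _]] := alt_leaf (alt_nil N).
have szt (u : (N.*2).-bseq bool) : (size (take (size u) w) <= N.*2)%N.
  by rewrite size_take_min sw geq_minr.
exists [ffun u => Bseq (szt u)].
have sz (u : (N.*2).-bseq bool) : size (take (size u) w) = size u.
  by rewrite size_takel // sw size_bseq.
split=> [u|u v|u]; rewrite ?ffunE /= ?sz //.
  move=> /ancestorP[_ lt]; apply/ancestorP; rewrite !sz; split=> //.
  by rewrite -(take_takel w (ltnW lt)) prefix_take.
exact: alt_prefix (prefix_take _ _) aw.
Qed.

Lemma Pr1 (R : realType) (T : set vertex) h (p : R * R) :
  (exists f, sticky (h := h) T f) ->
  (forall f, sticky (h := h) T f -> Kset f p) -> Pr T h p = 1.
Proof.
move=> [f0 st0] hit; rewrite /Pr (eq_card (B := [pred s | `[< sticky T s >] ])).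
  rewrite divff // pnatr_eq0 -lt0n; apply/card_gt0P.
  by exists f0; apply: asboolT.
by move=> f; rewrite !inE; apply: asbool_equiv_eq; split=> [[]|st] //; split=> //; apply: hit.
Qed.

Theorem theorem2 (R : realType) (N : nat) (hN : (1 <= N)%N) :
  exists (P : set vertex) (h : nat) (y : R),
    [/\ pruned N P, has_height P h, full_height P h,
        1 <= y <= 3 / 2 & Pr P h (1, y) = 1].
Proof.
exists (alt N), N.*2, (\sum_(i < N) 4 ^- i + 2 ^- N.*2.+1); split.
- exact: alt_pruned.
- exact: alt_height.
- exact: alt_full_height.
- exact: sum_inv4.
apply: Pr1 => [|f st]; first exact: sticky_exists.
have [j [sj Ej]] := sticky_alt_hit R st (leqnn N).
(* The term 2^-(2N+1) of y is half the length of Q_j, which puts the height at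
   abscissa 0 at the midpoint of Q_j. *)
exists j => //; apply: rho_mem; rewrite sj mul1r -Ej.
rewrite addrAC addrK ltrDl ltrD2l invr_gt0 exprn_gt0 //=.
by rewrite ltf_pV2 ?posrE ?exprn_gt0 // exprS ltr_pMl ?exprn_gt0 // ltr1n.
Qed.
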